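(* Let $\underline{\mathbb{Q}}^{+}=\{(x,y)\in\mathbb{N}^{+}\times\mathbb{N}^{+},\ \gcd(x,y)=1\}$, let $|\cdot|:\underline{\mathbb{Q}}^{+}\to\mathbb{R}$ be fundamentally monotone (i.e. $v\lll v'\Rightarrow |v|\le|v'|$), and for $R\in\mathbb{R}$ put $c(|\cdot|\le R)=\{v\in\underline{\mathbb{Q}}^{+}: |v|\le R\}$. If $c(|\cdot|\le R)$ is finite, then it is a corona.
   Context: Setting: $\underline{\mathbb{Q}}^{+}$ carries the Stern–Brocot binary tree structure: each $v=(x,y)$ corresponds to the unique $g_v=\begin{pmatrix}v_-\\ v_+\end{pmatrix}\in \mathrm{SL}_2(\mathbb{N})$ with $v=v_-+v_+$ (vector sum), where $\underline{0}=(1,0)$, $\underline{\infty}=(0,1)$ are allowed as $v_\pm$; the root is $(1,1)$ and the offspring of $v$ are $v+v_+$ and $v+v_-$; $M(v)$ (the mother) is the parent of $v$ in this tree. Edges of the Farey graph are pairs $(v_-,v_+)$ with $\det\begin{pmatrix}v_-\\ v_+\end{pmatrix}=1$. The tree order is $v'\lhd v$ iff $v'=M^n(v)$ for some $n\ge0$. Pointwise order: $(x,y)\prec(x',y')$ iff $x\le x'$ and $y\le y'$. Fundamental order: $v\lll v'$ iff $v_+\prec v'_+$ and $v_-\prec v'_-$ (the paper writes this order with a custom relation symbol). A $\lhd$-set is a finite subset $c\subseteq\underline{\mathbb{Q}}^{+}$ closed under $\lhd$-predecessors; writing its elements in increasing real order $c_1<\dots<c_{m-1}$ with $c_0=\underline{0}$,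 $c_m=\underline{\infty}$, consecutive elements form a path in the Farey graph from $\underline{0}$ to $\underline{\infty}$. $c^{\max}$ is the set of $\lhd$-maximal elements ($c_i=c_{i-1}+c_{i+1}$), $\Phi c=\{v\in c: v+v_+\in c \text{ and } v+v_-\in c\}$ (local $\lhd$-minima), $c^{\min}=\Phi c\cup\{\underline{0},\underline{\infty}\}$. A $\star$-set is a $\lhd$-set such that for every three consecutive points $c_{i+1}>c_i>c_{i-1}$, either $c_i\in c^{\max}$, or $c_i\in c^{\min}$, or $c_i=\tfrac12(c_{i+1}+c_{i-1})$. $\mathcal{C}^\star$ denotes the set of $\star$-sets. The set of coronas is $\bigcap_{n\ge0}\Phi^{-n}(\mathcal{C}^\star)$, i.e. $c$ such that $\Phi^n c$ is a $\star$-set for every $n\ge0$. *)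

(* Defs.v *)
From HB Require Import structures.
From mathcomp Require Import all_boot all_order all_algebra finmap.
From mathcomp Require Import boolp classical_sets cardinality reals.
From mathcomp Require Import zify.

Set Implicit Arguments.
Unset Strict Implicit.
Unset Printing Implicit Defensive.

Import Order.TTheory GRing.Theory Num.Theory.
Local Open Scope ring_scope.
Local Open Scope classical_set_scope.

(* Addition and natural multiples of vectors are the library's componentwise
   operations on products. *)
Definition vec : Type := (nat * nat)%type.

Definition vzero : vec := (1, 0)%N.
Definition vinfty : vec := (0, 1)%N.

Definition pw_le (v w : vec) : bool := (v.1 <= w.1)%N && (v.2 <= w.2)%N.

Definition vdet (p q : vec) : int :=
  p.1%:Z * q.2%:Z - p.2%:Z * q.1%:Z.

Definition positive_primitive (v : vec) : bool :=
  [&& (0 < v.1)%N, (0 < v.2)%N & coprime v.1 v.2].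

Record Qplus := MkQplus { qvec :> vec; _ : positive_primitive qvec }.

HB.instance Definition _ := [isSub for qvec].
HB.instance Definition _ := [Countable of Qplus by <:].

(* g = (p, q) stands for the 2x2 matrix with rows p and q. *)
Definition SL2N_for (v : vec) (g : vec * vec) : bool :=
  (vdet g.1 g.2 == 1) && (g.1 + g.2 == v).

Lemma SL2N_forP (x y a b c d : nat) :
  reflect [/\ (a * d = b * c + 1)%N, (a + c = x)%N & (b + d = y)%N]
          (SL2N_for (x, y) ((a, b), (c, d))).
Proof.
rewrite /SL2N_for /vdet /=; apply: (iffP andP).
  by case=> /eqP ? /eqP [<- <-]; split=> //; lia.
by case=> ? <- <-; split=> //; apply/eqP; lia.
Qed.

Lemma SL2N_for_ex (v : Qplus) : exists g, SL2N_for v g.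
Proof.
case: v => -[x y] /= /and3P[/= x0 y0 cxy].
have [n] := ubnP (x + y)%N; elim: n => // n IH in x y x0 y0 cxy *.
move=> lexy; case: (ltngtP x y) => xy.
- have [||||[[a b] [c d]] /SL2N_forP[h1 h2 h3]] := IH x (y - x)%N => //.
  + by rewrite subn_gt0.
  + by rewrite /coprime -gcdnDr subnK ?(ltnW xy).
  + by lia.
  by exists ((a, a + b), (c, c + d))%N; apply/SL2N_forP; split; lia.
- have [||||[[a b] [c d]] /SL2N_forP[h1 h2 h3]] := IH (x - y)%N y => //.
  + by rewrite subn_gt0.
  + by rewrite coprime_sym /coprime -gcdnDr subnK ?(ltnW xy) // gcdnC.
  + by lia.
  by exists ((a + b, b), (c + d, d))%N; apply/SL2N_forP; split; lia.
- move: cxy; rewrite xy /coprime gcdnn => /eqP->.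
  by exists ((1, 0), (0, 1))%N; apply/SL2N_forP.
Qed.

Lemma SL2N_for_uniq (v : vec) (g h : vec * vec) :
  SL2N_for v g -> SL2N_for v h -> g = h.
Proof.
case: v g h => x y [[a b] [c d]] [[a' b'] [c' d']].
move=> /SL2N_forP[g1 g2 g3] /SL2N_forP[h1 h2 h3].
have {}g1 : (a * y = b * x + 1)%N by nia.
have {}h1 : (a' * y = b' * x + 1)%N by nia.
have E : (a * b' * x + a = a' * b * x + a')%N by nia.
have [a0 a'0] : (0 < a)%N /\ (0 < a')%N by split; nia.
have ea : a = a'.
  by move: E; case: (ltngtP (a * b') (a' * b)) => ?; nia.
have eb : b = b' by nia.
by subst a' b'; congr (_, (_, _)); lia.
Qed.

Definition gmx (v : Qplus) : vec * vec := xchoose (SL2N_for_ex v).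
Definition vminus (v : Qplus) : vec := (gmx v).1.
Definition vplus (v : Qplus) : vec := (gmx v).2.

Lemma gmxP (v : Qplus) : SL2N_for v (gmx v).
Proof. exact: xchooseP. Qed.

Lemma gmx_eq (v : Qplus) (g : vec * vec) : SL2N_for v g -> gmx v = g.
Proof. exact: SL2N_for_uniq (gmxP v). Qed.

Lemma SL2N_offp (v : Qplus) :
  SL2N_for ((v : vec) + vplus v) (v : vec, vplus v).
Proof.
have := gmxP v; rewrite /vplus; case: (gmx v) => -[a b] [c d].
case: v => -[x y] /= _ /SL2N_forP[h1 h2 h3].
by apply/(SL2N_forP (x + c) (y + d)); subst x y; split; nia.
Qed.

Lemma SL2N_offm (v : Qplus) :
  SL2N_for ((v : vec) + vminus v) (vminus v, v : vec).
Proof.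
have := gmxP v; rewrite /vminus; case: (gmx v) => -[a b] [c d].
case: v => -[x y] /= _ /SL2N_forP[h1 h2 h3].
by apply/(SL2N_forP (x + a) (y + b)); subst x y; split; nia.
Qed.

Lemma SL2N_primitive (v : vec) (g : vec * vec) :
  SL2N_for v g -> coprime v.1 v.2.
Proof.
case: v g => x y [[a b] [c d]] /SL2N_forP[h1 h2 h3] /=.
have {}h1 : (a * y = b * x + 1)%N by nia.
have dbx : (gcdn x y %| b * x)%N by rewrite dvdn_mull ?dvdn_gcdl.
by rewrite /coprime -dvdn1 -(dvdn_addr 1 dbx) -h1 dvdn_mull ?dvdn_gcdr.
Qed.

Lemma positive_primitive_offp (v : Qplus) :
  positive_primitive ((v : vec) + vplus v).
Proof.
apply/and3P; split; last exact: SL2N_primitive (SL2N_offp v).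
- by case: v (vplus v) => -[x y] /= /and3P[/= x0 _ _] [c d] /=; rewrite ltn_addr.
- by case: v (vplus v) => -[x y] /= /and3P[/= _ y0 _] [c d] /=; rewrite ltn_addr.
Qed.

Lemma positive_primitive_offm (v : Qplus) :
  positive_primitive ((v : vec) + vminus v).
Proof.
apply/and3P; split; last exact: SL2N_primitive (SL2N_offm v).
- by case: v (vminus v) => -[x y] /= /and3P[/= x0 _ _] [c d] /=; rewrite ltn_addr.
- by case: v (vminus v) => -[x y] /= /and3P[/= _ y0 _] [c d] /=; rewrite ltn_addr.
Qed.

Definition offp (v : Qplus) : Qplus := MkQplus (positive_primitive_offp v).
Definition offm (v : Qplus) : Qplus := MkQplus (positive_primitive_offm v).

Definition offspring (u v : Qplus) : Prop := v = offp u \/ v = offm u.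

(* None exactly at the root (1, 1): see motherP and mother_root below. *)
Definition mother (v : Qplus) : option Qplus :=
  xget None [set o | exists2 u, o = Some u & offspring u v].

Lemma offspring_uniq (u u' v : Qplus) :
  offspring u v -> offspring u' v -> u = u'.
Proof.
suff key w w' : offp w = offm w' -> False.
  case=> ->; case=> E.
  - apply: val_inj => /=; have := SL2N_for_uniq (SL2N_offp u).
    have /(congr1 qvec) /= -> := E.
    by move=> /(_ _ (SL2N_offp u')) [].
  - by case: (key _ _ E).
  - by case: (key _ _ (esym E)).
  - apply: val_inj => /=; have := SL2N_for_uniq (SL2N_offm u).
    have /(congr1 qvec) /= -> := E.
    by move=> /(_ _ (SL2N_offm u')) [].
move=> /(congr1 qvec) /= E; have := SL2N_for_uniq (SL2N_offp w).
rewrite E => /(_ _ (SL2N_offm w')) [e1 e2].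
have := gmxP w; have := gmxP w'.
move: e1 e2; rewrite /vplus /vminus.
case: (gmx w) (gmx w') => -[a b] [c d] [[a' b'] [c' d']] /=.
case: w w' {E} => -[x y] /= _ [[x' y'] /= _] [-> ->] [-> ->].
move=> /SL2N_forP[_ h1 h2] /SL2N_forP[h3 h4 h5].
have a0 : a = 0%N by lia.
have b0 : b = 0%N by lia.
by move: h3; rewrite a0 b0.
Qed.

Lemma motherP (u v : Qplus) : mother v = Some u <-> offspring u v.
Proof.
rewrite /mother; split=> [|uv]; first by case: xgetP => // o -> [w -> ?] [<-].
by apply: xget_unique => [|_ [w -> wv]]; [exists u | rewrite (offspring_uniq uv wv)].
Qed.

Lemma mother_root (v : Qplus) : mother v = None <-> qvec v = (1, 1)%N.
Proof.
have nomother w : qvec w = (1, 1)%N -> forall u, ~ offspring u w.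
  move=> w1 u; have := gmxP u; case E: (gmx u) => [[a b] [c d]] Hu.
  case: u E Hu => -[x y] Hxy E /SL2N_forP[h1 h2 h3].
  have /and3P[/= x0 y0 _] := Hxy.
  case=> /(congr1 qvec); rewrite w1 /= /vplus /vminus E /= => -[e1 e2].
    have [c0 d0] : c = 0%N /\ d = 0%N by split; lia.
    by move: h1; rewrite c0 d0 !muln0.
  have [a0 b0] : a = 0%N /\ b = 0%N by split; lia.
  by move: h1; rewrite a0 b0.
split=> [|v1]; last first.
  by case E: mother => [u|//]; case: (nomother _ v1 u); apply/motherP.
apply: contraPP => v1; suff [u /motherP->] : exists u, offspring u v by [].
have [Hv vP] := (gmxP v, valP v); move: Hv vP v1.
case Ev : (gmx v) => [[a b] [c d]]; case: v Ev => -[x y] Hxy Ev.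
move=> /SL2N_forP[h1 h2 h3] /and3P[/= x0 y0 cxy] v1.
have {}v1 : ~ (x = 1 /\ y = 1)%N by case=> ex ey; apply: v1; rewrite ex ey.
have ey : y = (b + d)%N by [].
have ex : x = (a + c)%N by [].
have [ge|lt] := leqP (c + d) (a + b).
- have [ca db] : (c <= a)%N /\ (d <= b)%N by split; nia.
  have g' : SL2N_for (a, b) ((a - c, b - d), (c, d))%N.
    by apply/SL2N_forP; split; nia.
  have up : positive_primitive (a, b).
    by rewrite /positive_primitive (SL2N_primitive g') /=; nia.
  exists (MkQplus up); left; apply: val_inj; rewrite /= /vplus.
  by rewrite (gmx_eq (v := MkQplus up) g') /=; congr (_, _).
- have [ca db] : (a <= c)%N /\ (b <= d)%N by split; nia.
  have g' : SL2N_for (c, d) ((a, b), (c - a, d - b))%N.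
    by apply/SL2N_forP; split; nia.
  have up : positive_primitive (c, d).
    by rewrite /positive_primitive (SL2N_primitive g') /=; nia.
  exists (MkQplus up); right; apply: val_inj; rewrite /= /vminus.
  by rewrite (gmx_eq (v := MkQplus up) g') ex ey addnC [(b + d)%N]addnC.
Qed.

Definition tree_le (v' v : Qplus) : Prop :=
  exists n : nat, iter n (obind mother) (Some v) = Some v'.

Definition fund_le (v v' : Qplus) : Prop :=
  pw_le (vplus v) (vplus v') /\ pw_le (vminus v) (vminus v').

Definition tree_set (c : set Qplus) : Prop :=
  finite_set c /\ forall v' v, c v -> tree_le v' v -> c v'.

(* (x, y) stands for the number y / x, since 0 is (1, 0) and oo is (0, 1). *)
Definition ratio (v : Qplus) : rat := (qvec v).2%:R / (qvec v).1%:R.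

(* The sequence c_0, ..., c_m; meaningful for finite c only. *)
Definition farey_path (c : set Qplus) : seq vec :=
  vzero :: rcons
    (map qvec (sort (fun v w => ratio v <= ratio w) (fset_set c))) vinfty.

Definition cmax (c : set Qplus) : set Qplus :=
  [set v | c v /\ forall w, c w -> tree_le v w -> w = v].

Definition Phi (c : set Qplus) : set Qplus :=
  [set v | c v /\ c (offp v) /\ c (offm v)].

Definition cmin (c : set Qplus) : set vec :=
  qvec @` Phi c `|` [set vzero; vinfty].

(* The third alternative is c_i = (c_{i-1} + c_{i+1}) / 2 as vectors. *)
Definition star_set : set (set Qplus) :=
  [set c | tree_set c /\
    forall i : nat, (0 < i)%N -> (i.+1 < size (farey_path c))%N ->
      let pt j := nth vzero (farey_path c) j in
      [\/ (qvec @` cmax c) (pt i), cmin c (pt i)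
        | pt i *+ 2 = pt i.-1 + pt i.+1] ].

Definition corona : set (set Qplus) :=
  \bigcap_(n in [set: nat]) (iter n Phi @^-1` star_set).

Definition fund_monotone (R : realType) (nrm : Qplus -> R) : Prop :=
  forall v v' : Qplus, fund_le v v' -> nrm v <= nrm v'.

Definition sublevel (R : realType) (nrm : Qplus -> R) (r : R) : set Qplus :=
  [set v | nrm v <= r].

(* Main.v *)
Require Import Defs.
From mathcomp Require Import all_boot all_order all_algebra.
From mathcomp Require Import classical_sets cardinality reals.
From mathcomp Require Import finmap boolp zify.

Set Implicit Arguments.
Unset Strict Implicit.
Unset Printing Implicit Defensive.

Import Order.TTheory GRing.Theory Num.Theory.

Local Open Scope classical_set_scope.

(** The map Phi preserves finite down-sets of the fundamental order, because
    v <<< v' implies v + v_+ <<< v' + v'_+ and v + v_- <<< v' + v'_-; so it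
    suffices to show that every finite down-set c is a star-set.  It is closed
    under mothers since M(v) <<< v.  If a point v of c has exactly one offspring
    in c, say v + v_+, then its left neighbour in c is v_-, and its right
    neighbour is v + v_+: otherwise 2v + v_+, with matrix (v, v + v_+), would lie
    in c, hence also v + v_-, with matrix (v_-, v), which is fundamentally
    smaller.  Thus v is the midpoint of its neighbours. *)

(** * Down-sets of the fundamental order, and comparison of vectors by slope *)

Definition fund_closed (c : set Qplus) : Prop :=
  forall v v', fund_le v v' -> c v' -> c v.

(** Positivity of the determinant of [(p, q)], written without division or subtraction so that it
    also applies to [vzero] and [vinfty]. *)
Definition slope_lt (p q : vec) : bool := (p.2 * q.1 < p.1 * q.2)%N.

Lemma slope_lt_irr : irreflexive slope_lt.
Proof. by move=> p; rewrite /slope_lt mulnC ltnn. Qed.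

Lemma slope_lt_trans : transitive slope_lt.
Proof.
move=> [b1 b2] [a1 a2] [c1 c2]; rewrite /slope_lt /= => ab bc.
(* The two strict inequalities force both coordinates of the middle vector to be positive, so their
   product can be cancelled. *)
have b0 : (0 < b1 * b2)%N by rewrite muln_gt0; apply/andP; split; lia.
rewrite -(ltn_pmul2r b0).
have := ltn_mul ab bc.
by rewrite mulnACA mulnC [X in (_ < X)%N]mulnACA [X in (_ < X)%N]mulnC; lia.
Qed.

(** * Coordinates of the matrix of a point and of its offspring *)

Lemma Qplus_coords (v : Qplus) :
  [/\ (0 < (qvec v).1)%N, (0 < (qvec v).2)%N & coprime (qvec v).1 (qvec v).2].
Proof. by apply/and3P; case: v. Qed.

Lemma gmx_coords (v : Qplus) :
  [/\ ((vminus v).1 * (vplus v).2 = (vminus v).2 * (vplus v).1 + 1)%N,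
      ((vminus v).1 + (vplus v).1 = (qvec v).1)%N
    & ((vminus v).2 + (vplus v).2 = (qvec v).2)%N].
Proof.
have := gmxP v; rewrite /vplus /vminus.
case: (gmx v) => -[a b] [c d]; case: (qvec v) => x y.
by move/SL2N_forP.
Qed.

Lemma vplus_offp v : vplus (offp v) = vplus v.
Proof. by rewrite {1}/vplus (gmx_eq (v := offp v) (SL2N_offp v)). Qed.

Lemma vminus_offp v : vminus (offp v) = qvec v.
Proof. by rewrite {1}/vminus (gmx_eq (v := offp v) (SL2N_offp v)). Qed.

Lemma vplus_offm v : vplus (offm v) = qvec v.
Proof. by rewrite {1}/vplus (gmx_eq (v := offm v) (SL2N_offm v)). Qed.

Lemma vminus_offm v : vminus (offm v) = vminus v.
Proof. by rewrite {1}/vminus (gmx_eq (v := offm v) (SL2N_offm v)). Qed.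

(** * The fundamental order *)

Lemma pw_le_refl : reflexive pw_le.
Proof. by move=> v; rewrite /pw_le !leqnn. Qed.

Lemma pw_le_trans : transitive pw_le.
Proof. by move=> b a c; rewrite /pw_le; lia. Qed.

Lemma vminus_le v : pw_le (vminus v) (qvec v).
Proof. by have [_ ? ?] := gmx_coords v; rewrite /pw_le; lia. Qed.

Lemma vplus_le v : pw_le (vplus v) (qvec v).
Proof. by have [_ ? ?] := gmx_coords v; rewrite /pw_le; lia. Qed.

Lemma fund_le_refl v : fund_le v v.
Proof. by split; apply: pw_le_refl. Qed.

Lemma fund_le_trans u v w : fund_le u v -> fund_le v w -> fund_le u w.
Proof. by case=> ? ? [? ?]; split; apply: pw_le_trans; eassumption. Qed.

Lemma fund_le_pw (v w : Qplus) : fund_le v w -> pw_le v w.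
Proof.
have [_ ? ?] := gmx_coords v; have [_ ? ?] := gmx_coords w.
by rewrite /fund_le /pw_le => -[]; lia.
Qed.

Lemma fund_le_offp v w : fund_le v w -> fund_le (offp v) (offp w).
Proof.
move=> vw; rewrite /fund_le !vplus_offp !vminus_offp; split.
  by case: vw.
exact: fund_le_pw.
Qed.

Lemma fund_le_offm v w : fund_le v w -> fund_le (offm v) (offm w).
Proof.
move=> vw; rewrite /fund_le !vplus_offm !vminus_offm; split.
  exact: fund_le_pw.
by case: vw.
Qed.

Lemma fund_le_offspring u v : offspring u v -> fund_le u v.
Proof.
case=> ->; rewrite /fund_le ?vplus_offp ?vminus_offp ?vplus_offm ?vminus_offm.
  by split; [apply: pw_le_refl | apply: vminus_le].
by split; [apply: vplus_le | apply: pw_le_refl].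
Qed.

(** Used contrapositively: a down-set that misses [offm v] also misses the mediant of [v] and
    [offp v]. *)
Lemma fund_le_offm_offp v : fund_le (offm v) (offm (offp v)).
Proof.
rewrite /fund_le !(vminus_offp, vplus_offm, vminus_offm); split.
  by rewrite -(vminus_offp v) vminus_le.
exact: vminus_le.
Qed.

Lemma fund_le_offp_offm v : fund_le (offp v) (offp (offm v)).
Proof.
rewrite /fund_le !(vplus_offp, vminus_offp, vplus_offm); split.
  exact: vplus_le.
by rewrite -(vplus_offm v) vplus_le.
Qed.

Lemma tree_le_fund v w : tree_le v w -> fund_le v w.
Proof.
case=> n; elim: n v => [|n IHn] v /=; first by move=> [->]; apply: fund_le_refl.
case E: (iter n _ _) => [u|//] /= /motherP /fund_le_offspring vu.
exact: fund_le_trans vu (IHn _ E).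
Qed.

(* In the basis (v_-, v_+) the vector w has positive coprime coordinates (x, y);
   multiplying the matrix of (x, y) by that of v yields the matrix of w. *)
Lemma fund_le_between (v w : Qplus) :
  slope_lt (vminus v) w -> slope_lt w (vplus v) -> fund_le v w.
Proof.
have [dv _ _] := gmx_coords v; have [w1 w2 cw] := Qplus_coords w.
rewrite /slope_lt /fund_le.
move: (vminus v) (vplus v) dv => [a b] [c d] /= dv ltl ltr.
(* Cramer's rule for w = X v_- + Y v_+; the two slope hypotheses make the truncated subtractions
   exact and X, Y positive. *)
set X := ((qvec w).1 * d - (qvec w).2 * c)%N.
set Y := (a * (qvec w).2 - b * (qvec w).1)%N.
have eX : ((qvec w).1 * d = X + (qvec w).2 * c)%N by lia.
have eY : (a * (qvec w).2 = Y + b * (qvec w).1)%N by lia.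
have e1 : ((qvec w).1 = X * a + Y * c)%N.
  have := congr1 (muln a) eX; have := congr1 (muln c) eY.
  by have := congr1 (muln (qvec w).1) dv; lia.
have e2 : ((qvec w).2 = X * b + Y * d)%N.
  have := congr1 (muln b) eX; have := congr1 (muln d) eY.
  by have := congr1 (muln (qvec w).2) dv; lia.
have uP : positive_primitive (X, Y).
  apply/and3P; split; rewrite /=; [lia|lia|].
  (* A common divisor of X and Y divides both coordinates of [w]. *)
  rewrite /coprime -dvdn1 -(eqP cw) dvdn_gcd e1 e2.
  by rewrite !dvdn_add // dvdn_mulr // ?dvdn_gcdl ?dvdn_gcdr.
have := gmx_coords (MkQplus uP).
move: (vminus _) (vplus _) => [a' b'] [c' d'] /= [h1 h2 h3].
have gw : SL2N_for w ((a' * a + b' * c, a' * b + b' * d),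
                      (c' * a + d' * c, c' * b + d' * d))%N.
  rewrite [qvec w]surjective_pairing e1 e2; apply/SL2N_forP.
  rewrite -h2 -h3; split; try lia.
  by have := congr1 (muln (a * d)) h1; have := congr1 (muln (b * c)) h1; lia.
(* Determinant 1 makes the diagonal entries positive, so the rows of the product dominate (a, b) and
   (c, d) respectively. *)
have [a0 d0] : (0 < a')%N /\ (0 < d')%N by split; lia.
rewrite /vminus /vplus (gmx_eq gw) /pw_le /=; split; apply/andP; split.
- by rewrite (leq_trans (leq_pmull c d0)) ?leq_addl.
- by rewrite (leq_trans (leq_pmull d d0)) ?leq_addl.
- by rewrite (leq_trans (leq_pmull a a0)) ?leq_addr.
- by rewrite (leq_trans (leq_pmull b a0)) ?leq_addr.
Qed.

(** Both [vplus u] and [vplus v] complete u to a matrix of determinant 1, so v_+ = u_+ + k u for an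
    integer k. A negative k would make the first coordinate of u_+ at least that of u = u_- + u_+,
    although u_- has positive first coordinate. *)
Lemma fund_le_vminus u v : qvec u = vminus v -> fund_le u v.
Proof.
move=> uv; have [dv _ _] := gmx_coords v; have [du u1 u2] := gmx_coords u.
have [x0 y0 cu] := Qplus_coords u.
rewrite /fund_le; split; last by rewrite -uv vminus_le.
move: dv cu; rewrite -uv /pw_le.
move: (vminus u) (vplus u) (vplus v) (qvec u) du u1 u2 x0 y0 {uv} =>
  [a b] [c d] [p q] [x y] /= du u1 u2 x0 y0 dv cu.
have [cp|pc] := leqP c p; first by rewrite /=; nia.
have : (x %| c - p)%N.
  by rewrite -(Gauss_dvdr _ cu); apply/dvdnP; exists (d - q)%N; nia.
by move/dvdn_leq; rewrite subn_gt0 => /(_ pc); nia.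
Qed.

(** Mirror image of [fund_le_vminus]: v_- = u_- + k u, and k < 0 is excluded on second coordinates,
    where u_+ is positive. *)
Lemma fund_le_vplus u v : qvec u = vplus v -> fund_le u v.
Proof.
move=> uv; have [dv _ _] := gmx_coords v; have [du u1 u2] := gmx_coords u.
have [x0 y0 cu] := Qplus_coords u.
rewrite /fund_le; split; first by rewrite -uv vplus_le.
move: dv cu; rewrite -uv /pw_le.
move: (vminus u) (vplus u) (vminus v) (qvec u) du u1 u2 x0 y0 {uv} =>
  [a b] [c d] [p q] [x y] /= du u1 u2 x0 y0 dv cu.
have [bq|qb] := leqP b q; first by rewrite /=; nia.
have : (y %| b - q)%N.
  rewrite coprime_sym in cu.
  by rewrite -(Gauss_dvdr _ cu); apply/dvdnP; exists (a - p)%N; nia.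
by move/dvdn_leq; rewrite subn_gt0 => /(_ qb); nia.
Qed.

Lemma vminusE v : vminus v = vzero \/ exists u : Qplus, vminus v = qvec u.
Proof.
have [dv _ _] := gmx_coords v; move: (vminus v) (vplus v) dv => [a b] [c d] /= dv.
case: (posnP b) => [b0|b0].
  left; move: dv; rewrite b0 mul0n => /eqP.
  by rewrite muln_eq1 => /andP[/eqP-> _].
right; have uP : positive_primitive (a, b).
  apply/and3P; split; rewrite //=; first nia.
  have gb : (gcdn a b %| b * c)%N by rewrite dvdn_mulr ?dvdn_gcdr.
  by rewrite /coprime -dvdn1 -(dvdn_addr 1 gb) -dv dvdn_mulr ?dvdn_gcdl.
by exists (MkQplus uP).
Qed.

Lemma vplusE v : vplus v = vinfty \/ exists u : Qplus, vplus v = qvec u.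
Proof.
have [dv _ _] := gmx_coords v; move: (vminus v) (vplus v) dv => [a b] [c d] /= dv.
case: (posnP c) => [c0|c0].
  left; move: dv; rewrite c0 muln0 => /eqP.
  by rewrite muln_eq1 => /andP[_ /eqP->].
right; have uP : positive_primitive (c, d).
  apply/and3P; split; rewrite //=; first nia.
  have gb : (gcdn c d %| b * c)%N by rewrite dvdn_mull ?dvdn_gcdl.
  by rewrite /coprime -dvdn1 -(dvdn_addr 1 gb) -dv dvdn_mull ?dvdn_gcdr.
by exists (MkQplus uP).
Qed.

(** * The Farey path as a sequence strictly increasing in slope *)

Lemma Qplus_slope_inj (v w : Qplus) :
  ((qvec v).2 * (qvec w).1 = (qvec w).2 * (qvec v).1)%N -> v = w.
Proof.
have [v1 v2 cv] := Qplus_coords v; have [w1 w2 cw] := Qplus_coords w.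
move=> E; apply: val_inj => /=.
have E1 : (qvec v).1 = (qvec w).1.
  apply/eqP; rewrite eqn_dvd -(Gauss_dvdr _ cv) E dvdn_mull //=.
  by rewrite -(Gauss_dvdr _ cw) -E dvdn_mull.
rewrite [LHS]surjective_pairing [RHS]surjective_pairing E1; congr (_, _).
by move: E; rewrite E1 => /eqP; rewrite eqn_pmul2r // => /eqP.
Qed.

Lemma ratio_leE (v w : Qplus) :
  (Defs.ratio v <= Defs.ratio w)%R =
  ((qvec v).2 * (qvec w).1 <= (qvec w).2 * (qvec v).1)%N.
Proof.
have [v1 _ _] := Qplus_coords v; have [w1 _ _] := Qplus_coords w.
rewrite /Defs.ratio ler_pdivrMr ?ltr0n // mulrAC ler_pdivlMr ?ltr0n //.
by rewrite -!natrM ler_nat.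
Qed.

Lemma ratio_lt_slope (v w : Qplus) :
  (Defs.ratio v <= Defs.ratio w)%R -> v != w -> slope_lt v w.
Proof.
rewrite ratio_leE leq_eqVlt => /orP[/eqP/Qplus_slope_inj-> /eqP//|].
by rewrite /slope_lt [X in (_ < X)%N]mulnC.
Qed.

(** The path is sorted by the non-strict order on ratios; strictness comes from the absence of
    duplicates, since a reduced fraction is determined by its value. *)
Lemma farey_path_sorted c : pairwise slope_lt (farey_path c).
Proof.
rewrite /farey_path; set s := sort _ _.
rewrite pairwise_cons pairwise_rcons pairwise_map.
apply/and3P; split.
- apply/allP => p; rewrite mem_rcons inE => /predU1P[->//|/mapP[v _ ->]].
  by have [_ ? _] := Qplus_coords v; rewrite /slope_lt /= mul0n mul1n.
- apply/allP => p /mapP[v _ ->].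
  by have [? _ _] := Qplus_coords v; rewrite /slope_lt /= muln0 muln1.
have st : pairwise (fun v w => (Defs.ratio v <= Defs.ratio w)%R) s.
  rewrite -sorted_pairwise; last by move=> a b d; apply: le_trans.
  by apply: sort_sorted => a b; apply: le_total.
have us : pairwise (fun v w : Qplus => v != w) s.
  by rewrite -uniq_pairwise sort_uniq fset_uniq.
have := pairwise_relI (fun v w => (Defs.ratio v <= Defs.ratio w)%R)
  (fun v w : Qplus => v != w) s.
rewrite st us => H; apply: sub_pairwise H => v w /= /andP[].
exact: ratio_lt_slope.
Qed.

Lemma mem_farey_path c p : finite_set c ->
  (p \in farey_path c) <->
  [\/ p = vzero, p = vinfty | exists2 v : Qplus, c v & p = qvec v].
Proof.
move=> fc; rewrite /farey_path inE mem_rcons inE; split.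
  case/or3P => [/eqP->|/eqP->|/mapP[v]]; [exact: Or31|exact: Or32|].
  rewrite mem_sort => vc ->; apply: Or33; exists v => //.
  by move: vc; rewrite in_fset_set // => /set_mem.
case=> [->|->|[v cv ->]]; rewrite ?eqxx ?orbT //.
by rewrite map_f ?orbT // mem_sort in_fset_set //; apply/mem_set.
Qed.

(** Identifies a neighbour without computing its index j: j <= i contradicts the order, and j > i +
    1 would put entry i + 1 in the empty gap. *)
Lemma pairwise_next (T : eqType) (lt : rel T) (x0 : T) (s : seq T) i b :
  irreflexive lt -> transitive lt -> pairwise lt s -> (i < size s)%N ->
  b \in s -> lt (nth x0 s i) b ->
  (forall w, w \in s -> lt (nth x0 s i) w -> lt w b -> False) ->
  nth x0 s i.+1 = b.
Proof.
move=> irr tr /(pairwiseP x0) srt lti /(nthP x0)[j ltj <-] ltij nobet.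
case: (ltngtP j i.+1) => [ji|ij|->//].
- move: ji; rewrite ltnS leq_eqVlt => /predU1P[ji|ji]; first by rewrite ji irr in ltij.
  by have := tr _ _ _ ltij (srt _ _ ltj lti ji); rewrite irr.
- have lti1 : (i.+1 < size s)%N by apply: ltn_trans ltj.
  by case: (nobet (nth x0 s i.+1)); [exact: mem_nth|exact: srt|exact: srt].
Qed.

Lemma pairwise_prev (T : eqType) (lt : rel T) (x0 : T) (s : seq T) i b :
  irreflexive lt -> transitive lt -> pairwise lt s -> (i < size s)%N ->
  b \in s -> lt b (nth x0 s i) ->
  (forall w, w \in s -> lt b w -> lt w (nth x0 s i) -> False) ->
  nth x0 s i.-1 = b.
Proof.
move=> irr tr /(pairwiseP x0) srt lti /(nthP x0)[j ltj <-] ltji nobet.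
have [ij|ji|ij] := ltngtP i j.
- by have := tr _ _ _ ltji (srt _ _ lti ltj ij); rewrite irr.
(* Here j < i, so i is positive and [i.-1] is a genuine predecessor. *)
- case: (ltngtP j i.-1) => [ji1|?|->//]; last by lia.
  have lti1 : (i.-1 < size s)%N by lia.
  case: (nobet (nth x0 s i.-1)); [exact: mem_nth|exact: srt|].
  by apply: srt => //; lia.
- by rewrite ij irr in ltji.
Qed.

(** The matrix of [offp v] is (v, v_+), and its determinant is 1. *)
Lemma slope_lt_vplus (v : Qplus) : slope_lt v (vplus v).
Proof.
have [? _ _] := gmx_coords (offp v).
by rewrite /slope_lt -(vplus_offp v) -(vminus_offp v); lia.
Qed.

Lemma slope_lt_vminus (v : Qplus) : slope_lt (vminus v) v.
Proof.
have [? _ _] := gmx_coords (offm v).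
by rewrite /slope_lt -(vminus_offm v) -(vplus_offm v); lia.
Qed.

(** * Neighbours in the Farey path of a finite down-set *)

Lemma fund_closed_tree_set c : finite_set c -> fund_closed c -> tree_set c.
Proof. by move=> fc cc; split=> // v' v cv /tree_le_fund/cc; apply. Qed.

Lemma mem_vminus c v : finite_set c -> fund_closed c -> c v ->
  vminus v \in farey_path c.
Proof.
move=> fc cc cv; apply/mem_farey_path => //.
case: (vminusE v) => [->|[u E]]; first exact: Or31.
by apply: Or33; exists u => //; apply: cc cv; apply: fund_le_vminus.
Qed.

Lemma mem_vplus c v : finite_set c -> fund_closed c -> c v ->
  vplus v \in farey_path c.
Proof.
move=> fc cc cv; apply/mem_farey_path => //.
case: (vplusE v) => [->|[u E]]; first exact: Or32.
by apply: Or33; exists u => //; apply: cc cv; apply: fund_le_vplus.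
Qed.

(** Used contrapositively: a point missing from c leaves an empty gap between its two parents, as
    [pairwise_next] and [pairwise_prev] require. *)
Lemma farey_path_between c v p : finite_set c -> fund_closed c ->
  p \in farey_path c -> slope_lt (vminus v) p -> slope_lt p (vplus v) -> c v.
Proof.
move=> fc cc /(mem_farey_path _ fc)[->|->|[w cw ->] lt1 lt2].
- by rewrite /slope_lt /= muln1 muln0.
- by rewrite {2}/slope_lt /= mul0n mul1n.
- by apply: cc cw; apply: fund_le_between.
Qed.

(** A chain of mothers from some other w in c down to v passes through an offspring of v, which
    would lie in c. *)
Lemma no_offspring_cmax c v : tree_set c ->
  c v -> ~ c (offp v) -> ~ c (offm v) -> cmax c v.
Proof.
move=> [_ tc] cv np nm; split=> // w cw [[|n]] /=; first by case.
case E: (iter n _ _) => [u|//] /= /motherP vu.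
have cu : c u by apply: tc cw _; exists n.
by case: vu => uE; rewrite uE in cu.
Qed.

Lemma fund_closed_star c : finite_set c -> fund_closed c -> star_set c.
Proof.
move=> fc cc; have tc := fund_closed_tree_set fc cc.
split=> // i i0 lti p; set s := farey_path c in p *.
have srt := farey_path_sorted c.
have lti' : (i < size s)%N by apply: ltnW.
have : p i \in s by apply: mem_nth.
have nxt := pairwise_next (x0 := vzero) slope_lt_irr slope_lt_trans srt lti'.
have prv := pairwise_prev (x0 := vzero) slope_lt_irr slope_lt_trans srt lti'.
move: nxt prv; rewrite -/s -/(p i) -/(p i.+1) -/(p i.-1) => nxt prv.
move=> /(mem_farey_path _ fc)[E|E|[v cv E]].
- by apply: Or32; right; left.
- by apply: Or32; right; right.
rewrite E in nxt prv *.
have nobet u w : ~ c u -> w \in s ->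
    slope_lt (vminus u) w -> slope_lt w (vplus u) -> False.
  by move=> nu ws l1 l2; apply: nu; apply: farey_path_between ws l1 l2.
have [_ e1 e2] := gmx_coords v.
have [cp|ncp] := pselect (c (offp v)); have [cm|ncm] := pselect (c (offm v)).
- by apply: Or32; left; exists v.
(* The neighbours are v_- and v + v_+, with sum 2v. The left gap lies between the parents of the
   missing [offm v], the right gap between those of [offm (offp v)], which is missing too. *)
- apply: Or33; rewrite (nxt (qvec (offp v))) ?(prv (vminus v)).
  + rewrite mulr2n /= addrCA; congr (_ + _)%R.
    by apply/eqP; rewrite -pair_eqE /=; lia.
  + exact: mem_vminus.
  + exact: slope_lt_vminus.
  + move=> w ws; have := nobet (offm v) w ncm ws.
    by rewrite vminus_offm vplus_offm.
  + by apply/mem_farey_path => //; apply: Or33; exists (offp v).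
  + by rewrite -(vminus_offp v) slope_lt_vminus.
  + move=> w ws; have nc : ~ c (offm (offp v)).
      by move=> /(cc _ _ (fund_le_offm_offp v)).
    by have := nobet _ w nc ws; rewrite vminus_offm vplus_offm vminus_offp.
(* Mirror case: the neighbours are v + v_- and v_+, and the gaps belong to the missing points
   [offp (offm v)] and [offp v]. *)
- apply: Or33; rewrite (nxt (vplus v)) ?(prv (qvec (offm v))).
  + rewrite mulr2n /= -addrA; congr (_ + _)%R.
    by apply/eqP; rewrite -pair_eqE /=; lia.
  + by apply/mem_farey_path => //; apply: Or33; exists (offm v).
  + by rewrite -(vplus_offm v) slope_lt_vplus.
  + move=> w ws; have nc : ~ c (offp (offm v)).
      by move=> /(cc _ _ (fund_le_offp_offm v)).
    by have := nobet _ w nc ws; rewrite vminus_offp vplus_offp vplus_offm.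
  + exact: mem_vplus.
  + exact: slope_lt_vplus.
  + move=> w ws; have := nobet (offp v) w ncp ws.
    by rewrite vminus_offp vplus_offp.
- by apply: Or31; exists v => //; apply: no_offspring_cmax.
Qed.

(** * Stability under [Phi] and conclusion *)

Lemma fund_closed_Phi c : fund_closed c -> fund_closed (Phi c).
Proof.
move=> cc v w vw [cw [cp cm]]; split; first exact: cc cw.
split; first exact: cc (fund_le_offp vw) cp.
exact: cc (fund_le_offm vw) cm.
Qed.

Lemma finite_set_Phi c : finite_set c -> finite_set (Phi c).
Proof. by apply: sub_finite_set => v []. Qed.

Theorem theorem84 (R : realType) (nrm : Qplus -> R) (r : R) :
  fund_monotone nrm ->
  finite_set (sublevel nrm r) ->
  corona (sublevel nrm r).
Proof.
move=> mono fin n _ /=.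
have cc : fund_closed (sublevel nrm r).
  by move=> v w /mono vw; apply: le_trans vw.
(* Finiteness and closedness are carried together along the iterates, since [fund_closed_star]
   requires both. *)
suff [f' c'] : finite_set (iter n Phi (sublevel nrm r)) /\
               fund_closed (iter n Phi (sublevel nrm r)).
  exact: fund_closed_star.
elim: n => [|n [fn cn]] //=; split; first exact: finite_set_Phi.
exact: fund_closed_Phi.
Qed.
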